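(* Let $G$ be a finite quandle, $f$ an automorphism of $G$, $R$ a commutative ring, and $\phi: G\times G\to R^\times$ a quandle 2-cocycle. For an oriented virtual knot or link diagram $D$, let $C$ be the (finite) set of all possible colorings of $D$ with respect to $(G,f)$, and for $A\in C$ let $\prod_{c}\phi(x_c,y_c)^{\sigma_c t}$ denote the product, over all classical crossings $c$ of $D$, of the weights of $c$ in the coloring $A$ (with $t$ a formal parameter). 1. The state-weight $$Z_1(D,\phi,f)=\prod_{A\in C}\ \prod_{c}\phi(x_c,y_c)^{\sigma_c t}$$ is invariant under all classical and virtual Reidemeister moves, i.e. it is an invariant of the oriented virtual knot or link represented by $D$. 2. If $f$ and $\phi$ are aligned, i.e. $\phi(a,b)=\phi(f(a),f(b))$ for all $a,b\in G$, then the state-sum $$Z_2(D,\phi,f)=\sum_{A\in C}\ \prod_{c}\phi(x_c,y_c)^{\sigma_c t}$$ is invariant under all classical and virtual Reidemeister moves, i.e. it is an invariant of the oriented virtual knot or link represented by $D$. 3. If $\phi,\phi': G\times G\to R^\times$ are cohomologous 2-cocycles, then $Z_1(D,\phi,f)=Z_1(D,\phi',f)$ for every diagram $D$.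
   Context: Quandle: a set $G$ with a binary operation $\ast$ such that (i) $a\ast a=a$ for all $a$; (ii) for all $a,b\in G$ there is a unique $x\in G$ with $x\ast a=b$; (iii) $(a\ast b)\ast c=(a\ast c)\ast(b\ast c)$ for all $a,b,c$. An automorphism of $G$ is a bijection $f:G\to G$ with $f(a\ast b)=f(a)\ast f(b)$. 2-cocycle: a map $\phi:G\times G\to R^\times$ (units of a commutative ring $R$) with $\phi(a,a)=1$ and $\phi(a,b)\,\phi(a\ast b,c)=\phi(a,c)\,\phi(a\ast c,b\ast c)$ for all $a,b,c\in G$. It is a coboundary if $\phi(x,y)=\psi(x)\psi(x\ast y)^{-1}$ for some map $\psi:G\to R^\times$. Two 2-cocycles $\phi,\phi'$ are cohomologous if $\phi=\delta\cdot\phi'$ (pointwise product) for some coboundary 2-cocycle $\delta$. Virtual diagrams: an oriented virtual link diagram $D$ is a generic immersion of finitely many oriented circles in the oriented plane, with each double point designated either a classical crossing (with over/under information) or a virtual crossing. Two diagrams represent the same oriented virtual link if they are related by planar isotopy and finitely many classical Reidemeister moves $\Omega_1,\Omega_2,\Omega_3$ and virtual moves, with all orientations allowed. The virtual moves are the analogues of $\Omega_1,\Omega_2,\Omega_3$ in which all crossings are virtual (the first three virtual moves), and the mixed move $\Omega_3'$, in which a strand having two virtual crossings with the two strands of a classical crossing is moved across that classical crossing. Arcs: an arc of $D$ is a maximal piece of a component which contains no under-passage of a classical crossing and no virtual crossing in its interior (it may pass over classical crossings; a component with no under-passages and no virtual crossings is a single arc). Possible coloring: an assignment of an element of $G$ to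 each arc such that: (a) at each classical crossing, if the over-arc has color $y$ and the under-arc lying to the right of the oriented over-arc has color $x$, then the under-arc lying to the left of the over-arc has color $x\ast y$; (b) at each virtual crossing, the strand that crosses the other one from its left to its right (with respect to the orientation of the other strand) changes color from $a$ (incoming) to $f(a)$ (outgoing), and the strand that crosses the other one from its right to its left changes color from $b$ (incoming) to $f^{-1}(b)$ (outgoing). Weights: for a coloring and a classical crossing $c$, let $y_c$ be the color of the over-arc, $x_c$ the color of the under-arc on the right of the over-arc, and $\sigma_c\in\{1,-1\}$ the sign of the crossing (positive when the under-strand passes from right to left of the over-strand). The weight of $c$ is $\phi(x_c,y_c)^{\sigma_c t}$; virtual crossings have weight $1$. Formal parameter: for $u\in R^\times$, $u^{t}$ is a formal symbol subject to $u^tv^t=(uv)^t$, $u^{-t}=(u^{-1})^t$, $1^t=1$; that is, products of weights are regarded as elements of the group $R^\times$ and sums of such products as elements of the group ring $\mathbb{Z}[R^\times]$, with $u^t$ the basis element of $u$. *)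

(* Defs.v *)
From HB Require Import structures.
From mathcomp Require Import all_boot all_order all_algebra all_fingroup.
From mathcomp.multinomials Require Import monalg.
From Stdlib Require Import Relation_Operators.

Set Implicit Arguments.
Unset Strict Implicit.
Unset Printing Implicit Defensive.

Import GRing.Theory.
Local Open Scope ring_scope.

(** MathComp's [{unit R}] only exists for finite rings; here a unit carries its
    (unique) inverse, so that [R] can be any commutative ring. *)

Record units (R : comPzRingType) := Units {
  unit_pair : R * R;
  unit_pairP : unit_pair.1 * unit_pair.2 == 1 }.

HB.instance Definition _ (R : comPzRingType) := [isSub for @unit_pair R].
HB.instance Definition _ (R : comPzRingType) := [Choice of units R by <:].

Definition unit_val (R : comPzRingType) (u : units R) : R := (unit_pair u).1.
Coercion unit_val : units >-> GRing.ComPzRing.sort.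

Section Units.
Variable R : comPzRingType.
Implicit Types u v w : units R.

Lemma uone_proof : ((1, 1) : R * R).1 * ((1, 1) : R * R).2 == 1.
Proof. by rewrite mul1r. Qed.
Definition uone : units R := Units uone_proof.

Lemma umul_proof u v :
  let p := (unit_pair u).1 * (unit_pair v).1 in
  let q := (unit_pair u).2 * (unit_pair v).2 in (p, q).1 * (p, q).2 == 1.
Proof. by rewrite /= mulrACA (eqP (unit_pairP u)) (eqP (unit_pairP v)) mulr1. Qed.
Definition umul u v : units R := Units (umul_proof u v).

Lemma uinv_proof u :
  let p := ((unit_pair u).2, (unit_pair u).1) in p.1 * p.2 == 1.
Proof. by rewrite /= mulrC (eqP (unit_pairP u)). Qed.
Definition uinv u : units R := Units (uinv_proof u).

Lemma unit_val_inj : injective (@unit_val R).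
Proof.
move=> u v; rewrite /unit_val => e; apply: val_inj => /=.
move: (eqP (unit_pairP u)) (eqP (unit_pairP v)) e.
case: (unit_pair u) (unit_pair v) => [a b] [c d] /= ab cd e.
congr pair => //; move: ab; rewrite e => cb.
by rewrite -[b]mul1r -cd mulrAC cb mul1r.
Qed.

Lemma umulA : associative umul.
Proof. by move=> u v w; apply: unit_val_inj; rewrite /unit_val /= mulrA. Qed.
Lemma umulC : commutative umul.
Proof. by move=> u v; apply: unit_val_inj; rewrite /unit_val /= mulrC. Qed.
Lemma umul1u : left_id uone umul.
Proof. by move=> u; apply: unit_val_inj; rewrite /unit_val /= mul1r. Qed.
Lemma umulVu : left_inverse uone uinv umul.
Proof.
by move=> u; apply: unit_val_inj; rewrite /unit_val /= mulrC (eqP (unit_pairP u)).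
Qed.

HB.instance Definition _ :=
  Monoid.isComLaw.Build (units R) uone umul umulA umulC umul1u.
End Units.

Arguments uone {R}.

Definition quandle (G : Type) (op : G -> G -> G) : Prop :=
  [/\ forall a, op a a = a,
      forall a b, exists! x, op x a = b
    & forall a b c, op (op a b) c = op (op a c) (op b c)].

Section Cocycles.
Variables (G : Type) (op : G -> G -> G) (R : comPzRingType).
Implicit Types phi delta : G -> G -> units R.

Definition cocycle2 phi : Prop :=
  (forall a, phi a a = uone) /\
  (forall a b c, umul (phi a b) (phi (op a b) c) =
                 umul (phi a c) (phi (op a c) (op b c))).

Definition coboundary phi : Prop :=
  exists psi : G -> units R,
    forall x y, phi x y = umul (psi x) (uinv (psi (op x y))).

Definition cohomologous phi phi' : Prop :=
  exists delta, [/\ cocycle2 delta, coboundary delta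
    & forall x y, phi x y = umul (delta x y) (phi' x y)].

Definition aligned (f : G -> G) phi : Prop :=
  forall a b, phi a b = phi (f a) (f b).
End Cocycles.

(** An oriented virtual link diagram is encoded combinatorially.  The oriented
    circles carry a finite set of marked points, at least one on each circle:
    the two preimages of every double point, and possibly some auxiliary
    points.  The map [succ] sends a marked point to the next one along its circle, so that the circles
    are the cycles of [succ].  The label of a marked point [p] is
    - [None] if [p] is auxiliary;
    - [Some (k, b, q)] if [p] is one preimage of a double point and [q] the
      other one.  Then [k] tells whether the double point is virtual or, if it
      is a classical crossing, whether the strand through [p] is the over- or
      the under-strand; and [b] tells whether the strand through [p] crosses
      the strand through [q] from its right to its left ([b = true]) or from
      its left to its right ([b = false]).
    A code determines the diagram on the sphere up to isotopy and up to the
    relative position of the connected pieces of the diagram. *)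

Inductive passage := Over | Under | Virtual.

Definition opposite (k : passage) : passage :=
  match k with Over => Under | Under => Over | Virtual => Virtual end.

Definition label (P : Type) : Type := option (passage * bool * P).

Record code := Code {
  point : finType;
  succ : {perm point};
  lab : point -> label point }.

Definition pred_pt (D : code) (p : point D) : point D := (succ D)^-1%g p.

Definition crosses (P : Type) (l : P -> label P) (k : passage) (b : bool)
    (p q : P) : Prop :=
  l p = Some (k, b, q) /\ l q = Some (opposite k, ~~ b, p).

Definition well_formed (D : code) : Prop :=
  forall p k b q, lab p = Some (k, b, q) -> @crosses (point D) (@lab D) k b p q.

(** Planarity is Euler's formula.  The vertices are the auxiliary points and
    the double points (each counted at its right-to-left passage), the edges are
    the segments from [p] to [succ p].  A dart [(p, true)] (resp. [(p, false)]) is the segment from [p] to [succ p] run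
    along (resp. against) the orientation, and [face_next] follows the boundary
    of the face which lies to the left of a dart, turning left at each double
    point. *)

Section Planarity.
Variable D : code.

Definition is_vertex (p : point D) : bool :=
  if lab p is Some (_, b, _) then b else true.

Definition face_next (d : point D * bool) : point D * bool :=
  let: (p, fwd) := d in
  let v := if fwd then succ D p else p in
  match lab v with
  | None => if fwd then (v, true) else (pred_pt v, false)
  | Some (_, b, w) => if b == fwd then (pred_pt w, false) else (w, true)
  end.

Definition adjacent (p q : point D) : bool :=
  [|| q == succ D p, p == succ D q
    | if lab p is Some (_, _, r) then q == r else false].

Definition planar : Prop :=
  (#|[pred p | is_vertex p]| + fcard face_next {: point D * bool}
     = #|point D| + 2 * n_comp adjacent (point D))%N.
End Planarity.

Record diagram := Diagram {
  diagram_code :> code;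
  diagram_wf : well_formed diagram_code;
  diagram_planar : planar diagram_code }.

Definition map_label (P P' : Type) (h : P -> P') (l : label P) : label P' :=
  omap (fun x => (x.1, h x.2)) l.

Definition isomorphic (D D' : code) : Prop :=
  exists h : point D -> point D',
    [/\ bijective h, forall p, h (succ D p) = succ D' (h p)
      & forall p, lab (h p) = map_label h (lab p)].

(** [D'] is [D] with an auxiliary point [q] added between [p0] and
    [succ D p0]. *)
Definition subdivides (D' D : code) : Prop :=
  exists (h : point D -> point D') (p0 : point D) (q : point D'),
    [/\ injective h, forall r, r <> q <-> exists p, r = h p,
        forall p, succ D' (h p) = if p == p0 then q else h (succ D p),
        succ D' q = h (succ D p0)
      & lab q = None /\ forall p, lab (h p) = map_label h (lab p)].

(** The moves keep the marked points and the map [succ] and change the labels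
    [l] into [l'].  In each move the strands meeting the disk where it takes
    place are represented by pairs of consecutive points [p, s p]. *)

Section Moves.
Variables (P : finType) (s : {perm P}).
Implicit Types l : P -> label P.

Definition eq_off (A : seq P) l l' : Prop := forall p, p \notin A -> l p = l' p.

(** Both [b] and all [k] are allowed: this covers the curls of the two
    rotation directions, of the two signs, and the virtual ones. *)
Definition move1 l l' : Prop :=
  exists (p : P) (k : passage) (b : bool),
    [/\ l p = None, l (s p) = None, crosses l' k b p (s p)
      & eq_off [:: p; s p] l l'].

(** The strands are parallel if [par = true] and antiparallel otherwise;
    at both double points, the first strand passes over, under or virtually
    through the second one. *)
Definition move2 l l' : Prop :=
  exists (p1 p2 : P) (k : passage) (b par : bool),
    let A := [:: p1; s p1; p2; s p2] in
    [/\ uniq A, forall p, p \in A -> l p = None,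
        crosses l' k b p1 (if par then p2 else s p2),
        crosses l' k (~~ b) (s p1) (if par then s p2 else p2)
      & eq_off A l l'].

(** Three strands, the [i]-th one through [p_i] and [s p_i], bounding a
    triangle.  For (i,j) = (1,2), (2,3), (3,1), [k_ij] is the role of strand
    [i] at its crossing with strand [j], and [b_ij] tells whether strand [i]
    crosses strand [j] from right to left.  The order in which three oriented
    lines of the plane meet each other is then as follows: for (i,j,k) a cyclic
    permutation of (1,2,3), line [i] meets line [j] before line [k] if and only
    if [b_jk = d], where [d] tells on which side of the crossing of two of
    the lines the third one passes. *)
Definition triangle (p1 p2 p3 : P) (k12 k23 k31 : passage)
    (b12 b23 b31 d : bool) l : Prop :=
  let fst_if c p := if c then p else s p in
  [/\ crosses l k12 b12 (fst_if (b23 == d) p1) (fst_if (b31 != d) p2),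
      crosses l k23 b23 (fst_if (b31 == d) p2) (fst_if (b12 != d) p3)
    & crosses l k31 b31 (fst_if (b12 == d) p3) (fst_if (b23 != d) p1)].

Definition move3_gen (k12 k23 k31 : passage) l l' : Prop :=
  exists (p1 p2 p3 : P) (b12 b23 b31 d : bool),
    let A := [:: p1; s p1; p2; s p2; p3; s p3] in
    [/\ uniq A, triangle p1 p2 p3 k12 k23 k31 b12 b23 b31 d l,
        triangle p1 p2 p3 k12 k23 k31 b12 b23 b31 (~~ d) l'
      & eq_off A l l'].

(** Strand 1 is the top one, strand 2 the middle one, strand 3 the bottom
    one. *)
Definition move3 := move3_gen Over Over Under.

Definition virtual_move3 := move3_gen Virtual Virtual Virtual.

(** Strand 1 is the one with two virtual crossings; strand 2 passes over or
    under strand 3. *)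
Definition mixed_move3 l l' : Prop :=
  move3_gen Virtual Over Virtual l l' \/ move3_gen Virtual Under Virtual l l'.

Definition reidemeister l l' : Prop :=
  [\/ move1 l l', move2 l l', move3 l l' | virtual_move3 l l' \/ mixed_move3 l l'].
End Moves.

Inductive elementary_step : code -> code -> Prop :=
| StepIso D D' of isomorphic D D' : elementary_step D D'
| StepSubdivide D D' of subdivides D' D : elementary_step D D'
| StepMove (P : finType) (s : {perm P}) (l l' : P -> label P)
    of reidemeister s l l' : elementary_step (Code s l) (Code s l').

Definition same_virtual_link : diagram -> diagram -> Prop :=
  clos_refl_sym_trans diagram (fun D D' => elementary_step D D').

Section Arcs.
Variable D : code.

(** The segment from [p] to [succ p] is represented by its first point [p].
    The segments ending and starting at [q] are in the same arc unless [q] is an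
    under-passage or a passage through a virtual crossing. *)
Definition passes_through (q : point D) : bool :=
  match lab q with
  | None | Some (Over, _, _) => true
  | Some (Under, _, _) | Some (Virtual, _, _) => false
  end.

Definition glued (p q : point D) : bool :=
  (q == succ D p) && passes_through q || (p == succ D q) && passes_through p.

Definition arc_set (p : point D) : {set point D} :=
  [set q | connect glued p q].

Definition arc : finType := {a : {set point D} |
  a \in [set arc_set p | p in [set: point D]]}.

Definition arc_out (p : point D) : arc :=
  exist _ (arc_set p) (imset_f arc_set (in_setT p)).

Definition arc_in (p : point D) : arc := arc_out (pred_pt p).
End Arcs.

Section States.
Variables (G : finType) (op : G -> G -> G) (f : {perm G}).
Variables (R : comPzRingType) (phi : G -> G -> units R) (D : code).
Implicit Types A : {ffun arc D -> G}.

(** At an under-passage [p] with direction [b], the under-arc to the right of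
    the over-arc is the incoming one if [b] (positive crossing) and the
    outgoing one otherwise. *)
Definition right_arc (b : bool) (p : point D) := if b then arc_in p else arc_out p.
Definition left_arc (b : bool) (p : point D) := if b then arc_out p else arc_in p.

Definition coloring_at A (p : point D) : bool :=
  match lab p with
  | Some (Under, b, q) =>
      A (left_arc b p) == op (A (right_arc b p)) (A (arc_out q))
  | Some (Virtual, false, _) => A (arc_out p) == f (A (arc_in p))
  | Some (Virtual, true, _) => A (arc_out p) == f^-1%g (A (arc_in p))
  | Some (Over, _, _) | None => true
  end.

Definition colorings : {set {ffun arc D -> G}} :=
  [set A | [forall p, coloring_at A p]].

Definition weight A (p : point D) : units R :=
  match lab p with
  | Some (Under, b, q) =>
      let w := phi (A (right_arc b p)) (A (arc_out q)) in
      if b then w else uinv w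
  | _ => uone
  end.

(** A classical crossing is represented by its under-passage. *)
Definition is_under (p : point D) : bool :=
  if lab p is Some (Under, _, _) then true else false.

Definition state A : units R := \big[@umul R/uone]_(p | is_under p) weight A p.

Definition Z1 : units R := \big[@umul R/uone]_(A in colorings) state A.

(** [{malg int[units R]}] is the free abelian group on [units R], i.e. the
    additive group of the group ring. *)
Definition Z2 : {malg int[units R]} := \sum_(A in colorings) << state A >>.
End States.

(* Main.v *)
(** Colour the segments between consecutive marked points instead of the arcs.
    Traversing a marked point then acts on the colour by a permutation of [G]
    that is an automorphism of the quandle: a right translation or its inverse
    at an under-passage, [f] or its inverse at a virtual crossing.  Given the
    colours at the boundary of the disc where a move takes place, the interior
    colours exist before the move if and only if they exist after it, and they
    are unique; hence the colourings before and after the move correspond.  The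
    weights of corresponding colourings agree by the cocycle condition, except
    that in the mixed move the two colours at the classical crossing are both
    changed by [f] or its inverse.  This is harmless if [phi] is aligned with
    [f], and also for the product over all colourings, since [f] permutes the
    colourings.  For the same reason the contributions of a coboundary to the
    product over all colourings telescope along the circles. *)

Require Import Defs.
From mathcomp Require Import all_boot all_order all_algebra all_fingroup.
From mathcomp.multinomials Require Import monalg.

Set Implicit Arguments.
Unset Strict Implicit.
Unset Printing Implicit Defensive.

(** * Group laws for units *)

Section UnitLemmas.
Variable R : comPzRingType.
Implicit Types u v w z : units R.

Lemma umuluV u : umul u (uinv u) = uone.
Proof. by rewrite umulC umulVu. Qed.

Lemma umulVK u v : umul (uinv u) (umul u v) = v.
Proof. by rewrite umulA umulVu umul1u. Qed.

Lemma umul_inj u : injective (umul u).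
Proof. exact: can_inj (umulVK u). Qed.

Lemma uinv_unique u v : umul u v = uone -> uinv u = v.
Proof. by move=> uv1; apply: (@umul_inj u); rewrite umuluV. Qed.

Lemma uinvK u : uinv (uinv u) = u.
Proof. exact: uinv_unique (umulVu u). Qed.

Lemma uinv_mul u v : uinv (umul u v) = umul (uinv u) (uinv v).
Proof. by apply: uinv_unique; rewrite Monoid.mulmACA /= !umuluV umul1u. Qed.

Lemma uinv1 : uinv uone = uone :> units R.
Proof. by apply: uinv_unique; rewrite umul1u. Qed.

(** In the cocycle identity, [u] and [z] will be the weights of one crossing before and after the
    third move; inverting both reverses the sign of that crossing. *)
Lemma umul_exchange u v w z :
  umul u v = umul w z -> umul (uinv u) w = umul v (uinv z).
Proof.
move=> e; apply: (@umul_inj u); rewrite Monoid.mulmA /= umuluV umul1u umulA e.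
by rewrite -umulA umuluV Monoid.mulm1.
Qed.

End UnitLemmas.

Definition signed (gT : finGroupType) (b : bool) (u : gT) : gT :=
  if b then u else (u^-1)%g.

(** * Quandle translations and cocycles *)

Section RightTranslations.
Variables (G : finType) (op : G -> G -> G).
Hypothesis op_quandle : quandle op.

Lemma opI y : injective (op^~ y).
Proof.
case: op_quandle => _ div _ a b /= e.
by have [x [_ x_uniq]] := div y (op b y); rewrite -(x_uniq a e) (x_uniq b).
Qed.

Definition translation (y : G) : {perm G} := perm (@opI y).

Definition cross (b : bool) (y : G) : {perm G} := signed b (translation y).

Lemma cross_true y x : cross true y x = op x y.
Proof. by rewrite permE. Qed.

Lemma crossK b y x : cross b y (cross (~~ b) y x) = x.
Proof. by case: b; rewrite /cross /= ?permK ?permKV. Qed.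

Lemma cross_id b x : cross b x x = x.
Proof.
case: op_quandle => idem _ _; case: b; first by rewrite cross_true.
by rewrite -{2}(idem x) -cross_true (crossK false).
Qed.

Definition op_morph (g : {perm G}) : Prop := {morph g : a b / op a b}.

Lemma op_morph1 : op_morph 1%g.
Proof. by move=> a b; rewrite !perm1. Qed.

Lemma op_morphM g h : op_morph g -> op_morph h -> op_morph (g * h)%g.
Proof. by move=> gm hm a b; rewrite !permM gm hm. Qed.

Lemma op_morph_signed b g : op_morph g -> op_morph (signed b g).
Proof.
case: b => // gm x y; apply: (@perm_inj _ g).
by rewrite gm !permKV.
Qed.

Lemma morph_cross g b y x : op_morph g -> g (cross b y x) = cross b (g y) (g x).
Proof.
move=> gm; case: b; first by rewrite !cross_true gm.
apply: (@perm_inj _ (cross true (g y))).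
by rewrite (crossK true) cross_true -gm -cross_true (crossK true).
Qed.

Lemma op_morph_cross b y : op_morph (cross b y).
Proof.
apply: op_morph_signed => x z; rewrite !permE.
by case: op_quandle.
Qed.

(** Both translations and their inverses distribute over [op] and over its
    right division, so the four sign cases of the third axiom are one. *)
Lemma cross_cross b z b' y x :
  cross b z (cross b' y x) = cross b' (cross b z y) (cross b z x).
Proof. exact: morph_cross (@op_morph_cross b z). Qed.

Section Powers.
Variable f : {perm G}.
Hypothesis f_morph : op_morph f.

Lemma op_morph_cycle g : g \in <[f]>%g -> op_morph g.
Proof.
case/cycleP=> n ->; elim: n => [|n IHn]; first exact: op_morph1.
by rewrite expgS; apply: op_morphM.
Qed.

Lemma signed_cycle b : signed b f \in <[f]>%g.
Proof. by case: b; rewrite ?groupV cycle_id. Qed.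

Lemma cycle_commute g h x :
  g \in <[f]>%g -> h \in <[f]>%g -> g (h x) = h (g x).
Proof.
move=> gf hf; have /centsP c := cycle_abelian f.
by have /(congr1 (fun u : {perm G} => u x)) := c _ gf _ hf; rewrite !permM.
Qed.

Variables (R : comPzRingType) (phi : G -> G -> units R).
Hypothesis phi_aligned : aligned f phi.

Lemma aligned_cycle g : g \in <[f]>%g -> aligned g phi.
Proof.
case/cycleP=> n ->; elim: n => [|n IHn] a b; first by rewrite expg0 !perm1.
by rewrite expgS !permM -IHn.
Qed.
End Powers.

(** * Signed weights and the cocycle condition *)

Section Weights.
Variables (R : comPzRingType) (phi : G -> G -> units R).

(** The weight as a function of the incoming colour [x] of the under-strand,
    which lies to the right of the over-strand only if [b]. *)
Definition wt (b : bool) (x y : G) : units R :=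
  if b then phi x y else uinv (phi (cross false y x) y).

(** Both weights evaluate [phi] at the same colour to the right of the over-strand; this is the
    cancellation in the second move. *)
Lemma wtV b x y : wt b (cross (~~ b) y x) y = uinv (wt (~~ b) x y).
Proof. by case: b; rewrite /wt /= ?uinvK ?(crossK false). Qed.

Hypothesis phi_cocycle : cocycle2 op phi.

Lemma wt_id b x : wt b x x = uone.
Proof. by case: phi_cocycle => phi1 _; case: b; rewrite /wt ?cross_id phi1 ?uinv1. Qed.

Lemma wt_true_cocycle b a m z :
  umul (wt true a z) (wt b (op a z) (op m z)) =
  umul (wt b a m) (wt true (cross b m a) z).
Proof.
case: phi_cocycle => _ coc; case: b; rewrite /wt.
  by rewrite cross_true; exact/esym/coc.
(* At a negative crossing with [m], the cocycle condition applies to the outgoing colour [a'], which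
   lies to the right of the over-strand. *)
have [a' ->] : exists a', a = op a' m.
  by exists (cross false m a); rewrite -cross_true (crossK true).
have -> : cross false m (op a' m) = a' by rewrite -cross_true (crossK false).
have -> : cross false (op m z) (op (op a' m) z) = op a' z.
  by case: op_quandle => _ _ ->; rewrite -(cross_true (op m z)) (crossK false).
by rewrite (umul_exchange (coc a' m z)).
Qed.

(** This is the third move on weights, for all signs: [z] colours the top strand, [m] the middle one
    and [a] the bottom one. *)
Lemma wt_cocycle b b' a m z :
  umul (wt b a z) (wt b' (cross b z a) (cross b z m)) =
  umul (wt b' a m) (wt b (cross b' m a) z).
Proof.
case: b; first by rewrite !cross_true wt_true_cocycle.
(* A negative crossing with [z] is the positive case at the colours pulled back along [z]. *)
have := umul_exchange (wt_true_cocycle b' (cross false z a) (cross false z m) z).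
by rewrite -!(cross_true z) !(crossK true) -cross_cross.
Qed.
End Weights.
End RightTranslations.

#[global] Arguments cross : simpl never.
#[global] Arguments wt : simpl never.

(** * Colourings of segments *)

Section SegmentColorings.
Variables (G : finType) (op : G -> G -> G) (f : {perm G}).
Hypotheses (op_quandle : quandle op) (f_morph : op_morph op f).
Variable R : comPzRingType.
Implicit Types phi : G -> G -> units R.
Local Notation cross := (cross op_quandle).
Local Notation wt := (wt op_quandle).

Section Labels.
Variables (P : finType) (s : {perm P}).
Implicit Types (l : P -> label P) (c : P -> G) (p q : P).

(** [c p] is the colour of the segment from [p] to [s p]; [step l c p] turns the
    colour of the segment ending at [p] into that of the segment starting there. *)
Definition step l c p : {perm G} :=
  match l p with
  | Some (Under, b, q) => cross b (c q)
  | Some (Virtual, b, _) => signed (~~ b) f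
  | Some (Over, _, _) | None => 1%g
  end.

Definition transported l c p : bool := c p == step l c p (c ((s^-1)%g p)).

Definition segment_colorings l : {set {ffun P -> G}} :=
  [set c : {ffun P -> G} | [forall p, transported l c p]].

Definition point_weight phi l c p : units R :=
  if l p is Some (Under, b, q) then wt phi b (c ((s^-1)%g p)) (c q) else uone.

Definition total_weight phi l c : units R :=
  \big[@umul R/uone]_p point_weight phi l c p.

Lemma segment_coloringsP l (c : {ffun P -> G}) :
  reflect (forall p, c p = step l c p (c ((s^-1)%g p)))
          (c \in segment_colorings l).
Proof. by rewrite inE; apply: (iffP forallP) => c_ok p; apply/eqP/c_ok. Qed.

Lemma eq_step l l' c c' p :
  l p = l' p -> (forall k b q, l p = Some (k, b, q) -> c q = c' q) ->
  step l c p = step l' c' p.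
Proof.
rewrite /step => <-; case: (l p) => [[[[] b] q]|] // e.
by rewrite (e Under b q).
Qed.

Lemma eq_point_weight phi l l' c c' p :
  l p = l' p -> c ((s^-1)%g p) = c' ((s^-1)%g p) ->
  (forall k b q, l p = Some (k, b, q) -> c q = c' q) ->
  point_weight phi l c p = point_weight phi l' c' p.
Proof.
rewrite /point_weight => <- ->; case: (l p) => [[[[] b] q]|] // e.
by rewrite (e Under b q).
Qed.

Section CycleAction.
Variable g : {perm G}.
Hypothesis g_f : g \in <[f]>%g.

Definition recolor (c : P -> G) : {ffun P -> G} := [ffun p => g (c p)].

(** Classical steps are compatible with [g] because it is a quandle automorphism, virtual ones
    because powers of [f] commute. *)
Lemma step_recolor l c p x : step l (recolor c) p (g x) = g (step l c p x).
Proof.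
have g_morph := op_morph_cycle f_morph g_f.
rewrite /step; case: (l p) => [[[[] b] q]|]; rewrite ?perm1 ?ffunE //.
  by rewrite morph_cross.
exact: cycle_commute (signed_cycle _ _) g_f.
Qed.

Lemma recolor_segment_colorings l (c : {ffun P -> G}) :
  (recolor c \in segment_colorings l) = (c \in segment_colorings l).
Proof.
rewrite !inE; apply: eq_forallb => p.
by rewrite /transported !ffunE step_recolor (inj_eq perm_inj).
Qed.

Lemma big_recolor (M : Type) (idx : M) (mul : Monoid.com_law idx) l
    (F : {ffun P -> G} -> M) :
  \big[mul/idx]_(c in segment_colorings l) F c =
  \big[mul/idx]_(c in segment_colorings l) F (recolor c).
Proof.
have recolor_inj : injective (fun c : {ffun P -> G} => recolor c).
  move=> c c' /ffunP e; apply/ffunP=> p; apply: (@perm_inj _ g).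
  by have := e p; rewrite !ffunE.
rewrite (reindex_inj recolor_inj); apply: eq_bigl => c.
exact: recolor_segment_colorings.
Qed.

Lemma point_weight_recolor phi l c p :
  aligned g phi -> point_weight phi l (recolor c) p = point_weight phi l c p.
Proof.
move=> g_phi; rewrite /point_weight; case: (l p) => [[[[] b] q]|] //.
rewrite !ffunE /wt -(morph_cross _ _ _ _ (op_morph_cycle f_morph g_f)).
by rewrite -!g_phi.
Qed.
End CycleAction.
End Labels.

(** * From arcs to segments *)

Section Arcs.
Variables (M : Type) (idx : M) (mul : Monoid.com_law idx) (F : units R -> M).
Variable D : code.

Lemma arc_out_surj (a : Defs.arc D) : exists p, a == arc_out p.
Proof.
case: a => a a_arc; have /imsetP[p _ e] := a_arc.
by exists p; apply/eqP/val_inj.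
Qed.

Lemma glued_sym : connect_sym (@glued D).
Proof. by apply: sym_connect_sym => p q; rewrite /glued orbC. Qed.

Definition segment_coloring_of_arcs (A : {ffun Defs.arc D -> G}) : {ffun point D -> G} :=
  [ffun p => A (arc_out p)].

(** An arc receives the colour of a chosen segment in it; [connect_segment_coloring] makes the
    choice immaterial for segment colourings. *)
Definition arcs_of_segments (c : {ffun point D -> G}) : {ffun Defs.arc D -> G} :=
  [ffun a => c (xchoose (arc_out_surj a))].

Lemma segments_of_arcsK : cancel segment_coloring_of_arcs arcs_of_segments.
Proof.
move=> A; apply/ffunP=> a; rewrite !ffunE.
by rewrite -(eqP (xchooseP (arc_out_surj a))).
Qed.

Lemma arc_out_pred (p : point D) : passes_through p -> arc_out p = arc_in p.
Proof.
move=> pp; apply/val_inj/setP=> q; rewrite !inE.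
apply: (same_connect glued_sym); rewrite glued_sym; apply: connect1.
by rewrite /glued /pred_pt permKV eqxx pp.
Qed.

Lemma connect_segment_coloring (c : point D -> G) p q :
  (forall r, c r = step (@lab D) c r (c ((succ D)^-1%g r))) ->
  connect (@glued D) p q -> c p = c q.
Proof.
move=> c_ok /connectP[w]; elim: w p => [|r w IHw] p /=; first by move=> _ ->.
case/andP=> pr /IHw{}IHw /IHw <-.
have through u v : v = succ D u -> passes_through v -> c u = c v.
  move=> ->; rewrite /passes_through (c_ok (succ D u)) permK /step.
  by case: (lab _) => [[[[] b] q']|] //; rewrite perm1.
case/orP: pr => /andP[/eqP e]; first exact: through.
by move=> rv; apply/esym; apply: through.
Qed.

Lemma transported_arcs A p :
  transported (succ D) (@lab D) (segment_coloring_of_arcs A) p =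
  coloring_at op f A p.
Proof.
rewrite /transported /step /coloring_at !ffunE.
have out := @arc_out_pred p; rewrite /passes_through in out.
case: (lab p) out => [[[[] b] q]|] out; rewrite ?perm1 ?ffunE.
- by rewrite out // eqxx.
- rewrite /arc_in /pred_pt; case: b => /=; first by rewrite cross_true.
  (* At a negative crossing the right arc is the outgoing one, so both sides are compared after
     crossing back. *)
  rewrite -(inj_eq (@perm_inj _ (cross true (A (arc_out q))))).
  by rewrite (crossK _ true) cross_true eq_sym.
- by case: b.
by rewrite out // eqxx.
Qed.

Lemma big_colorings phi :
  \big[mul/idx]_(A in colorings op f D) F (state phi A) =
  \big[mul/idx]_(c in segment_colorings (succ D) (@lab D))
     F (total_weight (succ D) phi (@lab D) c).
Proof.
rewrite [RHS](reindex_onto segment_coloring_of_arcs arcs_of_segments).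
  apply: eq_big => [A|A A_ok].
    rewrite segments_of_arcsK eqxx andbT !inE; apply: eq_forallb => p.
    by rewrite transported_arcs.
  congr F; rewrite /state big_mkcond; apply: eq_bigr => p _.
  rewrite inE in A_ok; have := forallP A_ok p.
  rewrite /coloring_at /is_under /weight /point_weight /wt.
  case: (lab p) => [[[[] b] q]|] //; rewrite !ffunE; case: b => // /eqP /=.
  by rewrite /arc_in /pred_pt => ->; rewrite -(cross_true op_quandle) (crossK _ false).
move=> c /segment_coloringsP c_ok; apply/ffunP=> p; rewrite !ffunE.
have := congr1 val (eqP (xchooseP (arc_out_surj (arc_out p)))).
set q := xchoose _ => /= /setP/(_ q); rewrite !inE connect0.
by move=> /(connect_segment_coloring c_ok) ->.
Qed.
End Arcs.

(** * Renaming and subdividing the marked points *)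

Section Refinements.
Variables (P P' : finType) (s : {perm P}) (s' : {perm P'}).
Variables (l : P -> label P) (l' : P' -> label P') (h : P -> P') (g : P' -> P).
Hypotheses (hK : cancel h g) (l'h : forall p, l' (h p) = map_label h (l p)).
Hypothesis g_pred : forall p, g ((s'^-1)%g (h p)) = (s^-1)%g p.
Hypothesis unlabelled :
  forall r, h (g r) != r -> l' r = None /\ (s'^-1)%g r = h (g r).

Lemma step_image (c : P' -> G) p : step l' c (h p) = step l (fun q => c (h q)) p.
Proof. by rewrite /step l'h; case: (l p) => [[[[] b] q]|]. Qed.

Lemma refined_coloring (c : {ffun P' -> G}) r :
  c \in segment_colorings s' l' -> c r = c (h (g r)).
Proof.
move=> /segment_coloringsP c_ok.
have [-> //|/unlabelled[l'r r_pred]] := eqVneq (h (g r)) r.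
by rewrite {1}c_ok /step l'r perm1 r_pred.
Qed.

(** This serves isomorphisms and subdivisions alike: a point outside the image of [h] is unlabelled,
    so it copies the colour of its predecessor and has weight [uone]. *)
Lemma big_refinement (M : Type) (idx : M) (mul : Monoid.com_law idx)
    (F : units R -> M) phi :
  \big[mul/idx]_(c in segment_colorings s' l') F (total_weight s' phi l' c) =
  \big[mul/idx]_(c in segment_colorings s l) F (total_weight s phi l c).
Proof.
rewrite [RHS](reindex_onto (fun c : {ffun P' -> G} => [ffun p => c (h p)])
  (fun c : {ffun P -> G} => [ffun r => c (g r)])); last first.
  by move=> c _; apply/ffunP=> p; rewrite !ffunE hK.
apply: eq_big => [c|c c_ok].
  apply/idP/andP=> [c_ok|[/segment_coloringsP c_ok /eqP/ffunP ce]].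
    split; last by apply/eqP/ffunP=> r; rewrite !ffunE -refined_coloring.
    apply/segment_coloringsP=> p; rewrite !ffunE.
    have /segment_coloringsP -> := c_ok.
    rewrite step_image (refined_coloring _ c_ok) g_pred.
    by congr (fun_of_perm _ _); apply: eq_step => // *; rewrite ffunE.
  apply/segment_coloringsP=> r.
  have e q : c q = c (h (g q)) by rewrite -[in LHS]ce !ffunE.
  have [hr|/unlabelled[l'r r_pred]] := eqVneq (h (g r)) r; last first.
    by rewrite /step l'r perm1 r_pred -e.
  rewrite -hr step_image [in RHS]e g_pred; have := c_ok (g r); rewrite !ffunE => ->.
  by congr (fun_of_perm _ _); apply: eq_step => // *; rewrite ffunE.
congr F; rewrite /total_weight (bigID [pred r | h (g r) == r]) /=.
rewrite [X in umul _ X]big1 => [|r /unlabelled[l'r _]]; last by rewrite /point_weight l'r.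
rewrite Monoid.mulm1 (reindex_onto h g); last by move=> r /eqP.
apply: eq_big => [p|p _]; first by rewrite hK !eqxx.
rewrite /point_weight l'h; case: (l p) => [[[[] b] q]|] //=; rewrite !ffunE.
by rewrite (refined_coloring _ c_ok) g_pred.
Qed.
End Refinements.

Section Cohomologous.
Variables (P : finType) (s : {perm P}).

(** The under-passage [p] contributes [psi (c (s^-1 p)) / psi (c p)].  The other
    points can be counted in as well: the two colours are equal at an
    over-passage, and at a virtual passage they have the same product of [psi]
    over all colourings. *)
Lemma cohomologous_total_weight (l : P -> label P) phi phi' :
  cohomologous op phi phi' ->
  \big[@umul R/uone]_(c in segment_colorings s l) total_weight s phi l c =
  \big[@umul R/uone]_(c in segment_colorings s l) total_weight s phi' l c.
Proof.
case=> delta [_ [psi delta_psi] phi_eq].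
have -> : \big[@umul R/uone]_(c in segment_colorings s l) total_weight s phi l c =
  umul (\big[@umul R/uone]_(c in segment_colorings s l) total_weight s delta l c)
       (\big[@umul R/uone]_(c in segment_colorings s l) total_weight s phi' l c).
  rewrite -big_split; apply: eq_bigr => c _; rewrite -big_split; apply: eq_bigr => p _.
  rewrite /= /point_weight; case: (l p) => [[[[] b] q]|]; rewrite ?umul1u //.
  by case: b; rewrite /wt !phi_eq ?uinv_mul.
pose total p := \big[@umul R/uone]_(c in segment_colorings s l) psi (c p).
suff -> : \big[@umul R/uone]_(c in segment_colorings s l) total_weight s delta l c =
  \big[@umul R/uone]_p umul (total ((s^-1)%g p)) (uinv (total p)).
  rewrite big_split /=.
  have <- : \big[@umul R/uone]_p total p = \big[@umul R/uone]_p total ((s^-1)%g p).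
    exact: (reindex_inj (@perm_inj _ s^-1%g)).
  by rewrite -big_split big1 ?umul1u // => p _; exact: umuluV.
rewrite exchange_big; apply: eq_bigr => p _ /=.
have uinv_total : uinv (total p) =
    \big[@umul R/uone]_(c in segment_colorings s l) uinv (psi (c p)).
  by rewrite (big_morph _ (@uinv_mul R) (@uinv1 R)).
have c_step (c : {ffun P -> G}) : c \in segment_colorings s l ->
    c p = step l c p (c ((s^-1)%g p)) by move/segment_coloringsP.
rewrite /point_weight; move: c_step; rewrite /step.
case: (l p) => [[[[] b] q]|] c_step; first 1 last.
- rewrite uinv_total /total -big_split; apply: eq_bigr => c /c_step ->.
  case: b {c_step}; rewrite /wt delta_psi -(cross_true op_quandle) //.
  by rewrite (crossK _ true) uinv_mul uinvK umulC.
- rewrite big1 // {1}/total (big_recolor _ (signed_cycle f (~~ b))).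
  rewrite (eq_bigr (fun c : {ffun P -> G} => psi (c p))) ?umuluV // => c.
  by move/c_step; rewrite ffunE => ->.
- rewrite big1 // /total (eq_bigr (fun c : {ffun P -> G} => psi (c p))) ?umuluV // => c.
  by move/c_step; rewrite perm1 => ->.
rewrite big1 // /total (eq_bigr (fun c : {ffun P -> G} => psi (c p))) ?umuluV // => c.
by move/c_step; rewrite perm1 => ->.
Qed.

End Cohomologous.

(** * Local replacements *)

Section LocalMoves.
Variables (P : finType) (s : {perm P}).
Implicit Types (l : P -> label P) (c : P -> G) (I : seq P).

(** [I] lists the first points of the strands meeting the disc of a move, so it
    represents the interior segments, whereas [disc I] lists the points whose
    label changes. *)
Definition disc I : seq P := I ++ map s I.

Definition solves l I c : bool :=
  all (fun p => transported s l c p && (c (s p) == step l c (s p) (c p))) I.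

Definition agree_off I c c' : Prop := forall p, p \notin I -> c p = c' p.

Definition determined I l : Prop :=
  forall c c', solves l I c -> solves l I c' -> agree_off I c c' -> {in I, c =1 c'}.

Definition extends I l l' : Prop :=
  forall c, solves l I c ->
  exists2 c' : {ffun P -> G}, solves l' I c' & agree_off I c c'.

Definition disc_weight phi l I c : units R :=
  \big[@umul R/uone]_(p <- I)
    umul (point_weight s phi l c p) (point_weight s phi l c (s p)).

(** The twist [g] accounts for the mixed move, where the weight in the disc is
    only preserved up to recolouring by a power of [f]. *)
Record replaceable phi (g : {perm G}) I l l' : Prop := Replaceable {
  replaceable_uniq : uniq (disc I);
  replaceable_off : forall p, p \notin disc I -> l p = l' p;
  replaceable_closed : forall p k b q,
    l p = Some (k, b, q) -> q \in disc I -> p \in disc I;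
  replaceable_determined : determined I l /\ determined I l';
  replaceable_extends : extends I l l' /\ extends I l' l;
  replaceable_weight : forall c c',
    solves l I c -> solves l' I c' -> agree_off I c c' ->
    disc_weight phi l I (recolor g c) = disc_weight phi l' I c' }.

Lemma agree_off_sym I c c' : agree_off I c c' -> agree_off I c' c.
Proof. by move=> cc' p /cc'. Qed.

Lemma notin_disc I p : p \notin disc I -> p \notin I /\ (s^-1)%g p \notin I.
Proof.
rewrite mem_cat negb_or => /andP[-> pI]; split=> //.
by apply: contraNN pI => sp; rewrite -(permKV s p) map_f.
Qed.

(** * Correspondence of colourings under a local replacement *)

Section Replace.
Variables (phi : G -> G -> units R) (g : {perm G}) (I : seq P).
Variables l l' : P -> label P.
Hypothesis ll' : replaceable phi g I l l'.

Lemma solves_coloring (l0 : P -> label P) (c : {ffun P -> G}) :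
  c \in segment_colorings s l0 -> solves l0 I c.
Proof.
move=> /segment_coloringsP c_ok; apply/allP=> p _.
by rewrite /transported -c_ok eqxx [c (s p)]c_ok permK eqxx.
Qed.

(** Off the disc the conditions for [l] and [l'] coincide, and inside it they are those of [solves].
    The symmetric form serves both directions. *)
Lemma coloring_of_solution (c c' : {ffun P -> G}) :
  agree_off I c c' -> (c \in segment_colorings s l) && solves l' I c' =
                      (c' \in segment_colorings s l') && solves l I c.
Proof.
move=> cc'; have eq_out p : p \notin disc I ->
    (c p == step l c p (c ((s^-1)%g p))) = (c' p == step l' c' p (c' ((s^-1)%g p))).
  move=> pI; have [pI1 pI2] := notin_disc pI; rewrite !cc' //.
  rewrite (@eq_step _ l l' c c') //; first exact: (replaceable_off ll').
  move=> k b q lp; apply: cc'; apply: contraNN pI => qI.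
  by apply: (replaceable_closed ll' lp); rewrite mem_cat qI.
have ext (l0 : P -> label P) (c0 : {ffun P -> G}) : solves l0 I c0 ->
    (forall p, p \notin disc I -> c0 p = step l0 c0 p (c0 ((s^-1)%g p))) ->
    c0 \in segment_colorings s l0.
  move=> /allP sol out; apply/segment_coloringsP=> p.
  have [|/out //] := boolP (p \in disc I); rewrite mem_cat.
  case/orP=> [/sol/andP[/eqP //]|/mapP[q /sol/andP[_ /eqP e] ->]].
  by rewrite e permK.
apply/andP/andP=> -[c_ok sol]; split; try exact: solves_coloring c_ok.
  apply: ext => // p /eq_out e; apply/eqP; rewrite -e.
  by move/segment_coloringsP: c_ok => <-.
apply: ext => // p /eq_out e; apply/eqP; rewrite e.
by move/segment_coloringsP: c_ok => <-.
Qed.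

Lemma big_replaceable (M : Type) (idx : M) (mul : Monoid.com_law idx)
    (F F' : {ffun P -> G} -> M) :
  (forall c c' : {ffun P -> G},
     c \in segment_colorings s l -> c' \in segment_colorings s l' ->
     agree_off I c c' -> F c = F' c') ->
  \big[mul/idx]_(c in segment_colorings s l) F c =
  \big[mul/idx]_(c in segment_colorings s l') F' c.
Proof.
move=> FF'.
have ffun_inj (l0 : P -> label P) (c c' : {ffun P -> G}) : determined I l0 ->
    c \in segment_colorings s l0 -> c' \in segment_colorings s l0 ->
    agree_off I c c' -> c = c'.
  move=> det /solves_coloring sc /solves_coloring sc' cc'; apply/ffunP=> p.
  by have [pI|/cc'] := boolP (p \in I); [exact: (det c c')|].
have [[det det'] [ext ext']] := (replaceable_determined ll', replaceable_extends ll').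
pose agree (c c' : {ffun P -> G}) := [forall p, (p \in I) || (c p == c' p)].
have agreeP (c c' : {ffun P -> G}) : reflect (agree_off I c c') (agree c c').
  apply: (iffP forallP) => [e p pI|e p]; first by have := e p; rewrite (negPf pI) => /eqP.
  by have [//|/e/eqP] := boolP (p \in I).
have fwd (c : {ffun P -> G}) : c \in segment_colorings s l ->
    exists2 c' : {ffun P -> G}, c' \in segment_colorings s l' & agree_off I c c'.
  move=> c_ok; have [c' sc' cc'] := ext c (solves_coloring c_ok).
  by exists c' => //; have := coloring_of_solution cc'; rewrite c_ok sc' => /esym/andP[].
have bwd (c' : {ffun P -> G}) : c' \in segment_colorings s l' ->
    exists2 c : {ffun P -> G}, c \in segment_colorings s l & agree_off I c c'.
  move=> c'_ok; have [c sc /agree_off_sym cc'] := ext' c' (solves_coloring c'_ok).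
  by exists c => //; have := coloring_of_solution cc'; rewrite c'_ok sc => /andP[].
(* The defaults are never taken on colourings, by [fwd] and [bwd]; uniqueness of the interior
   colours makes [to] and [from] mutually inverse. *)
pose to (c : {ffun P -> G}) := odflt c [pick c' in segment_colorings s l' | agree c c'].
pose from (c' : {ffun P -> G}) := odflt c' [pick c in segment_colorings s l | agree c c'].
have toP (c : {ffun P -> G}) : c \in segment_colorings s l ->
    to c \in segment_colorings s l' /\ agree_off I c (to c).
  case/fwd=> c' c'_ok cc'; rewrite /to; case: pickP => [d /andP[? /agreeP] //|/(_ c')].
  by rewrite c'_ok; case: agreeP.
have fromP (c' : {ffun P -> G}) : c' \in segment_colorings s l' ->
    from c' \in segment_colorings s l /\ agree_off I (from c') c'.
  case/bwd=> c c_ok cc'; rewrite /from; case: pickP => [d /andP[? /agreeP] //|/(_ c)].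
  by rewrite c_ok; case: agreeP.
rewrite [RHS](reindex_onto to from) => [|c' c'_ok]; last first.
  have [from_ok from_c'] := fromP c' c'_ok; have [to_ok to_c'] := toP _ from_ok.
  by apply: (ffun_inj l') => // p pI; rewrite -to_c' // from_c'.
apply: eq_big => [c|c c_ok]; last by have [] := toP c c_ok; exact: FF'.
apply/idP/andP=> [c_ok|[to_ok /eqP <-]]; last by have [] := fromP _ to_ok.
have [to_ok cto] := toP c c_ok; split=> //; have [from_ok fc] := fromP _ to_ok.
by apply/eqP/(ffun_inj l) => // p pI; rewrite fc // -cto.
Qed.

Definition outer_weight (l0 : P -> label P) (c : P -> G) : units R :=
  \big[@umul R/uone]_(p | p \notin disc I) point_weight s phi l0 c p.

Lemma total_weight_split l0 c :
  total_weight s phi l0 c = umul (outer_weight l0 c) (disc_weight phi l0 I c).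
Proof.
rewrite /total_weight (bigID (mem (disc I))) umulC /=; congr (umul _ _).
rewrite -big_uniq ?(replaceable_uniq ll') //= big_cat big_map.
by rewrite /disc_weight big_split.
Qed.

Lemma eq_outer_weight c c' :
  agree_off I c c' -> outer_weight l c = outer_weight l' c'.
Proof.
move=> cc'; apply: eq_bigr => p pI; have [pI1 pI2] := notin_disc pI.
apply: eq_point_weight; [exact: (replaceable_off ll')|exact: cc'|move=> k b q lp].
apply: cc'; apply: contraNN pI => qI.
by apply: (replaceable_closed ll' lp); rewrite mem_cat qI.
Qed.

(** Alignment makes the twist by [g] invisible to the weights, so corresponding colourings have
    equal total weight. *)
Lemma big_replaceable_aligned (M : Type) (idx : M) (mul : Monoid.com_law idx)
    (F : units R -> M) :
  g \in <[f]>%g -> aligned g phi ->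
  \big[mul/idx]_(c in segment_colorings s l) F (total_weight s phi l c) =
  \big[mul/idx]_(c in segment_colorings s l') F (total_weight s phi l' c).
Proof.
move=> g_f g_phi; apply: big_replaceable => c c' c_ok c'_ok cc'; congr F.
rewrite !total_weight_split (eq_outer_weight cc'); congr (umul _ _).
transitivity (disc_weight phi l I (recolor g c)).
  by apply: eq_bigr => p _; rewrite !(point_weight_recolor s g_f).
by apply: (replaceable_weight ll'); rewrite ?solves_coloring.
Qed.

(** The product splits into outer and disc factors; recolouring by [g], which permutes the
    colourings, is applied to the disc factor alone. *)
Lemma prod_replaceable :
  g \in <[f]>%g ->
  \big[@umul R/uone]_(c in segment_colorings s l) total_weight s phi l c =
  \big[@umul R/uone]_(c in segment_colorings s l') total_weight s phi l' c.
Proof.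
move=> g_f; under eq_bigr do rewrite total_weight_split.
rewrite big_split /= [X in umul _ X](big_recolor _ g_f) -big_split.
apply: big_replaceable => c c' c_ok c'_ok cc'.
rewrite total_weight_split (eq_outer_weight cc') /=; congr (umul _ _).
by apply: (replaceable_weight ll'); rewrite ?solves_coloring.
Qed.
End Replace.

(** In a layered disc the colour of each interior segment is determined by the
    colours of the preceding ones and of the boundary segments. *)
Fixpoint layered l I : bool :=
  if I is p :: J then
    (if l p is Some (Under, _, q) then q \notin I else true) && layered l J
  else true.

(** These conditions compute the interior colours; those at the exits [s p] then constrain the
    boundary colours. *)
Definition enters l I c : Prop :=
  forall p, p \in I -> c p = step l c p (c ((s^-1)%g p)).

Lemma solvesP l I c :
  reflect (enters l I c /\ forall p, p \in I -> c (s p) = step l c (s p) (c p))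
          (solves l I c).
Proof.
apply: (iffP allP) => [sol|[ent lea] p pI].
  by split=> p /sol/andP[/eqP e1 /eqP e2].
by rewrite /transported -ent // -lea // !eqxx.
Qed.

Lemma uniq_disc_neighbours I p : uniq (disc I) -> p \in I ->
  s p \notin I /\ (s^-1)%g p \notin I.
Proof.
rewrite cat_uniq => /and3P[_ /hasPn sI _] pI; split; first by apply: sI; rewrite map_f.
by apply: contraL pI => /(map_f s)/sI; rewrite permKV.
Qed.

Lemma eq_layered_step l p (J : seq P) c c' x : layered l (p :: J) ->
  agree_off (p :: J) c c' -> step l c p x = step l c' p x.
Proof.
rewrite /step /= => lay cc'; case: (l p) lay => [[[[] b] q]|] // /andP[qJ _].
by rewrite cc'.
Qed.

Lemma layered_unique l I c c' :
  layered l I -> {in I, forall p, c ((s^-1)%g p) = c' ((s^-1)%g p)} ->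
  enters l I c -> enters l I c' -> agree_off I c c' -> c =1 c'.
Proof.
elim: I => [_ _ _ _ cc' p|p J IHJ lay pred ec ec' cc']; first exact: cc'.
have cp : c p = c' p.
  have pI := mem_head p J.
  by rewrite (ec p pI) (ec' p pI) (pred p pI) (eq_layered_step _ lay cc').
apply: IHJ; first by case/andP: lay.
- by move=> q qJ; apply: pred; rewrite in_cons qJ orbT.
- by move=> q qJ; apply: ec; rewrite in_cons qJ orbT.
- by move=> q qJ; apply: ec'; rewrite in_cons qJ orbT.
move=> q qJ; have [->//|qp] := eqVneq q p.
by apply: cc'; rewrite in_cons (negPf qp).
Qed.

(** [K] remains the full list of interior points while the induction shortens [I]: predecessors lie
    outside [K], so no update changes their colours. *)
Lemma layered_fill l I (K : seq P) c :
  layered l I -> uniq I -> {in I, forall p, (s^-1)%g p \notin K} ->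
  {subset I <= K} ->
  exists2 c' : {ffun P -> G}, enters l I c' & agree_off I c c'.
Proof.
elim: I c => [|p J IHJ] c lay; first by exists (finfun c) => // q; rewrite ffunE.
move=> /andP[pJ uJ] pred JK; have layJ : layered l J by case/andP: lay.
pose c1 q := if q == p then step l c p (c ((s^-1)%g p)) else c q.
have [||c' ec' c1c'] := IHJ c1 layJ uJ.
- by move=> q qJ; apply: pred; rewrite in_cons qJ orbT.
- by move=> q qJ; apply: JK; rewrite in_cons qJ orbT.
have cc' : agree_off (p :: J) c c'.
  by move=> q; rewrite in_cons negb_or => /andP[qp qJ]; rewrite -c1c' // /c1 (negPf qp).
exists c' => // q; rewrite in_cons => /orP[/eqP->|/ec' //].
rewrite -(c1c' p) // /c1 eqxx (eq_layered_step _ lay cc') cc' //.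
by apply: contra (pred p (mem_head _ _)); apply: JK.
Qed.

(** Layering fills in the interior colours uniquely, which leaves only the exit conditions and the
    weights to compare. *)
Lemma replaceable_of_layered phi g I l l' :
  well_formed (Code s l) -> uniq (disc I) ->
  (forall p, p \notin disc I -> l p = l' p) ->
  (forall q k b p, q \in disc I -> l q = Some (k, b, p) -> p \in disc I) ->
  layered l I -> layered l' I ->
  (forall c c', agree_off I c c' -> solves l I c -> enters l' I c' ->
     forall p, p \in I -> c' (s p) = step l' c' (s p) (c' p)) ->
  (forall c c', agree_off I c c' -> solves l' I c -> enters l I c' ->
     forall p, p \in I -> c' (s p) = step l c' (s p) (c' p)) ->
  (forall c c', agree_off I c c' -> solves l I c -> solves l' I c' ->
     disc_weight phi l I (recolor g c) = disc_weight phi l' I c') ->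
  replaceable phi g I l l'.
Proof.
move=> wf uI off closed lay lay' ll' l'l w.
have pred p : p \in I -> (s^-1)%g p \notin I by case/(uniq_disc_neighbours uI).
have det l0 : layered l0 I -> determined I l0.
  move=> lay0 c c' /solvesP[ec _] /solvesP[ec' _] cc' p _.
  by apply: (layered_unique lay0 _ ec ec' cc') => q /pred /cc'.
have uniqI : uniq I by move: uI; rewrite cat_uniq => /andP[].
split=> //; last by move=> c c' sc sc' cc'; exact: w.
- by move=> p k b q /wf[_ lq] qI; exact: closed lq.
- by split; exact: det.
split=> c sc.
  have [c' ec' cc'] := layered_fill c lay' uniqI pred (fun _ => id).
  by exists c' => //; apply/solvesP; split=> //; exact: ll' sc ec'.
have [c' ec' cc'] := layered_fill c lay uniqI pred (fun _ => id).
by exists c' => //; apply/solvesP; split=> //; exact: l'l sc ec'.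
Qed.

(** * Reidemeister moves *)

(** The triangles whose first strand never goes under and whose second strand goes
    at most under the first, so that the strands are layered in this order. *)
Definition triangular (k12 k23 k31 : passage) : bool :=
  match k12, k23, k31 with
  | Over, Over, Under | Virtual, Virtual, Virtual | Virtual, Over, Virtual => true
  | _, _, _ => false
  end.

(** Both orders of the passages give the same outgoing colours: by self-distributivity if all are
    classical, since [f] is an automorphism in the mixed case, and since powers of [f] commute if
    all are virtual. *)
Lemma triangle_leaves k12 k23 k31 p1 p2 p3 b12 b23 b31 d l l' c c' :
  let I := [:: p1; p2; p3] in
  uniq (disc I) -> triangular k12 k23 k31 ->
  triangle s p1 p2 p3 k12 k23 k31 b12 b23 b31 d l ->
  triangle s p1 p2 p3 k12 k23 k31 b12 b23 b31 (~~ d) l' ->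
  agree_off I c c' -> solves l I c -> enters l' I c' ->
  forall p, p \in I -> c' (s p) = step l' c' (s p) (c' p).
Proof.
have fV_morph : op_morph op f^-1%g := op_morph_signed false f_morph.
move=> I uI kinds tl tl' cc' /solvesP[ec lc] ec'.
have nb p : p \in I -> c' (s p) = c (s p) /\ c' ((s^-1)%g p) = c ((s^-1)%g p).
  by move=> /(uniq_disc_neighbours uI)[sp spV]; rewrite !cc'.
have [I1 I2 I3] : [/\ p1 \in I, p2 \in I & p3 \in I] by rewrite !inE !eqxx !orbT.
have [[n1 m1] [n2 m2] [n3 m3]] := And3 (nb _ I1) (nb _ I2) (nb _ I3).
suff e : [/\ c' (s p1) = step l' c' (s p1) (c' p1),
             c' (s p2) = step l' c' (s p2) (c' p2)
           & c' (s p3) = step l' c' (s p3) (c' p3)].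
  by case: e => e1 e2 e3 p; rewrite !inE => /or3P[] /eqP->.
move: (ec _ I1) (lc _ I1) (ec _ I2) (lc _ I2) (ec _ I3) (lc _ I3).
move: (ec' _ I1) (ec' _ I2) (ec' _ I3); rewrite /step.
(* Three kinds of triangle and sixteen patterns of directions remain. Below, [a], [x], [y], [e] name
   the incoming colours, the interior ones for [l] and for [l'], and the outgoing ones. *)
case: k12 k23 k31 kinds tl tl' => [] [] [] // _;
  case: b12 b23 b31 d => [] [] [] []
    [[L1 L2] [L3 L4] [L5 L6]] [[L1' L2'] [L3' L4'] [L5' L6']].
all: rewrite /= in L1 L2 L3 L4 L5 L6 L1' L2' L3' L4' L5' L6'.
all: rewrite ?L1 ?L2 ?L3 ?L4 ?L5 ?L6 ?L1' ?L2' ?L3' ?L4' ?L5' ?L6'.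
all: rewrite ?n1 ?n2 ?n3 ?m1 ?m2 ?m3 /= ?perm1.
all: move: (c p1) (c p2) (c p3) (c (s p1)) (c (s p2)) (c (s p3)).
all: move: (c' p1) (c' p2) (c' p3) (c _) (c _) (c _).
all: move=> y1 y2 y3 a3 a2 a1 x1 x2 x3 e1 e2 e3.
all: clear -f_morph fV_morph; move=> *; subst.
all: split; rewrite ?permK ?permKV //.
all: rewrite 1?(cross_cross _ _ a1) ?(crossK _ true) ?(crossK _ false) //.
all: rewrite ?(morph_cross _ _ _ _ f_morph) ?(morph_cross _ _ _ _ fV_morph).
all: by rewrite ?permK ?permKV.
Qed.

(** The exponent is read off strand 3. If [b12 == d], it meets strand 1 before strand 2 in the
    initial triangle, and the twist undoes that virtual passage; otherwise the twist performs it. *)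
Definition triangle_twist k12 (b12 b31 d : bool) : {perm G} :=
  if k12 is Virtual then signed (if b12 == d then b31 else ~~ b31) f else 1%g.

Lemma triangle_weight phi k12 k23 k31 p1 p2 p3 b12 b23 b31 d l l' c c' :
  let I := [:: p1; p2; p3] in
  cocycle2 op phi -> uniq (disc I) -> triangular k12 k23 k31 ->
  triangle s p1 p2 p3 k12 k23 k31 b12 b23 b31 d l ->
  triangle s p1 p2 p3 k12 k23 k31 b12 b23 b31 (~~ d) l' ->
  agree_off I c c' -> solves l I c -> solves l' I c' ->
  disc_weight phi l I (recolor (triangle_twist k12 b12 b31 d) c) =
  disc_weight phi l' I c'.
Proof.
move=> I coc uI kinds tl tl' cc' /solvesP[ec lc] /solvesP[ec' lc'].
have nb p : p \in I -> c' (s p) = c (s p) /\ c' ((s^-1)%g p) = c ((s^-1)%g p).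
  by move=> /(uniq_disc_neighbours uI)[sp spV]; rewrite !cc'.
have [I1 I2 I3] : [/\ p1 \in I, p2 \in I & p3 \in I] by rewrite !inE !eqxx !orbT.
have [[n1 m1] [n2 m2] [n3 m3]] := And3 (nb _ I1) (nb _ I2) (nb _ I3).
rewrite /disc_weight !big_cons !big_nil /point_weight !permK.
move: (ec _ I1) (lc _ I1) (ec _ I2) (lc _ I2) (ec _ I3) (lc _ I3).
move: (ec' _ I1) (lc' _ I1) (ec' _ I2) (lc' _ I2) (ec' _ I3) (lc' _ I3); rewrite /step.
case: k12 k23 k31 kinds tl tl' => [] [] [] // _;
  case: b12 b23 b31 d => [] [] [] []
    [[L1 L2] [L3 L4] [L5 L6]] [[L1' L2'] [L3' L4'] [L5' L6']].
all: rewrite /= in L1 L2 L3 L4 L5 L6 L1' L2' L3' L4' L5' L6'.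
all: rewrite ?L1 ?L2 ?L3 ?L4 ?L5 ?L6 ?L1' ?L2' ?L3' ?L4' ?L5' ?L6'.
all: rewrite ?ffunE ?n1 ?n2 ?n3 ?m1 ?m2 ?m3 /= ?perm1.
all: move: (c p1) (c p2) (c p3) (c (s p1)) (c (s p2)) (c (s p3)).
all: move: (c' p1) (c' p2) (c' p3) (c _) (c _) (c _).
all: move=> y1 y2 y3 a3 a2 a1 x1 x2 x3 e1 e2 e3.
all: clear -f_morph coc; move=> *; subst.
(* The twist settles the virtual and mixed cases; the classical ones follow from [wt_cocycle] with
   top colour [a1]. *)
all: rewrite ?umul1u ?Monoid.mulm1 ?permK ?permKV //.
all: by rewrite -(wt_cocycle _ coc _ _ _ _ a1) ?(crossK _ true) ?(crossK _ false).
Qed.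

Lemma triangle_layered k12 k23 k31 p1 p2 p3 b12 b23 b31 d l :
  uniq (disc [:: p1; p2; p3]) -> triangular k12 k23 k31 ->
  triangle s p1 p2 p3 k12 k23 k31 b12 b23 b31 d l -> layered l [:: p1; p2; p3].
Proof.
rewrite /disc /= !inE !negb_or -!andbA => uI kinds tl; move: uI; do ![case/andP=> ?] => _.
case: k12 k23 k31 kinds tl => [] [] [] // _;
  case: b12 b23 b31 d => [] [] [] [] [[L1 L2] [L3 L4] [L5 L6]].
all: rewrite /= in L1 L2 L3 L4 L5 L6.
all: rewrite ?L1 ?L2 ?L3 ?L4 ?L5 ?L6 //= ?inE ?negb_or.
all: by do ?[apply/andP; split] => //; rewrite eq_sym.
Qed.

Lemma triangle_closed k12 k23 k31 p1 p2 p3 b12 b23 b31 d l q k b p :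
  triangle s p1 p2 p3 k12 k23 k31 b12 b23 b31 d l ->
  q \in disc [:: p1; p2; p3] -> l q = Some (k, b, p) ->
  p \in disc [:: p1; p2; p3].
Proof.
case: b12 b23 b31 d => [] [] [] [] [[L1 L2] [L3 L4] [L5 L6]].
all: rewrite /= in L1 L2 L3 L4 L5 L6.
all: rewrite /disc /= !inE; do 5?[case/orP]; move=> /eqP->.
all: by rewrite ?L1 ?L2 ?L3 ?L4 ?L5 ?L6 => -[_ _ <-]; rewrite eqxx ?orbT.
Qed.

Lemma triangle_replaceable phi k12 k23 k31 p1 p2 p3 b12 b23 b31 d l l' :
  cocycle2 op phi -> well_formed (Code s l) ->
  uniq (disc [:: p1; p2; p3]) -> triangular k12 k23 k31 ->
  triangle s p1 p2 p3 k12 k23 k31 b12 b23 b31 d l ->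
  triangle s p1 p2 p3 k12 k23 k31 b12 b23 b31 (~~ d) l' ->
  eq_off (disc [:: p1; p2; p3]) l l' ->
  replaceable phi (triangle_twist k12 b12 b31 d) [:: p1; p2; p3] l l'.
Proof.
move=> coc wf uI kinds tl tl' ll'; apply: replaceable_of_layered => //.
- by move=> q k b p; exact: triangle_closed tl.
- exact: triangle_layered tl.
- exact: triangle_layered tl'.
- by move=> c c' cc' sc ec'; exact: (triangle_leaves uI kinds tl tl' cc' sc ec').
- move=> c c' cc' sc ec'; rewrite -[d]negbK in tl.
  exact: (triangle_leaves uI kinds tl' tl cc' sc ec').
by move=> c c' cc' sc sc'; exact: (triangle_weight coc uI kinds tl tl' cc' sc sc').
Qed.

(** Exchanging strands 2 and 3 turns the mixed move with strand 2 under strand 3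
    into the one with strand 2 over strand 3. *)
Lemma triangle_swap k12 k23 k31 p1 p2 p3 b12 b23 b31 d l :
  triangle s p1 p2 p3 k12 k23 k31 b12 b23 b31 d l ->
  triangle s p1 p3 p2 (opposite k31) (opposite k23) (opposite k12)
    (~~ b31) (~~ b23) (~~ b12) d l.
Proof.
have opK k : opposite (opposite k) = k by case: k.
have eqN (a b : bool) : ((~~ a == b) = (a != b)) * ((~~ a != b) = (a == b)).
  by case: a b => [] [].
by case=> [[? ?] [? ?] [? ?]]; split; rewrite /crosses !opK !negbK !eqN.
Qed.

Lemma perm_disc I : perm_eq (flatten [seq [:: p; s p] | p <- I]) (disc I).
Proof.
elim: I => //= p I IHI; rewrite perm_cons perm_sym (perm_catCA I [:: s p]) perm_cons.
by rewrite perm_sym.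
Qed.

Lemma move1_replaceable phi l l' :
  cocycle2 op phi -> well_formed (Code s l) -> move1 s l l' ->
  exists I, replaceable phi 1%g I l l'.
Proof.
move=> coc wf [p [k [b [lp lsp [l'p l'sp] ll']]]]; exists [:: p].
have psp : p != s p.
  (* If [p] and [s p] coincided, one label would carry both directions [b] and [~~ b]. *)
  by apply/eqP=> e; move: l'sp; rewrite -e l'p => -[_ /esym]; case: (b).
have uI : uniq (disc [:: p]) by rewrite /disc /= inE psp.
have [n m] := uniq_disc_neighbours uI (mem_head p [::]).
have pI := mem_head p [::].
(* A strand passing under its own colour keeps it, by idempotence and injectivity of
   translations. *)
have cross_fix e a : e = cross b e a -> e = a.
  by rewrite -{1}(cross_id op_quandle b e) => /perm_inj.
apply: replaceable_of_layered => //.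
- by move=> q k' b' p'; rewrite !inE => /orP[]/eqP->; rewrite ?lp ?lsp.
- by rewrite /= lp.
- by rewrite /= l'p inE eq_sym (negPf psp); case: (k).
- move=> c c' cc' /solvesP[ec lc] ec' q; rewrite inE => /eqP->.
  move: (ec' p pI) (ec p pI) (lc p pI).
  rewrite /step lp lsp l'p l'sp !perm1 (cc' _ m) (cc' _ n) => -> -> ->.
  case: (k); rewrite /= ?perm1 ?cross_id //.
  by case: (b); rewrite /= ?permK ?permKV.
- move=> c c' cc' /solvesP[ec lc] ec' q; rewrite inE => /eqP->.
  move: (ec' p pI) (ec p pI) (lc p pI).
  rewrite /step lp lsp l'p l'sp !perm1 -(cc' _ m) -(cc' _ n) => ->.
  case: (k) => /=; rewrite ?perm1 ?cross_id.
  + by move=> ->.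
  + by move=> e1 e2; apply: cross_fix; rewrite -e1.
  by move=> -> ->; case: (b); rewrite /= ?permK ?permKV.
move=> c c' cc' /solvesP[ec lc] /solvesP[ec' lc'].
rewrite /disc_weight !big_seq1 /point_weight lp lsp l'p l'sp !permK umul1u.
move: (ec' p pI) (lc' p pI) (ec p pI) (lc p pI).
rewrite /step lp lsp l'p l'sp !perm1 (cc' _ m) (cc' _ n).
case: (k) => /=; rewrite ?umul1u ?Monoid.mulm1 ?wt_id // => _ _ -> ->.
by rewrite wt_id.
Qed.

(** Naming the strands so that the first never goes under makes the disc layered. *)
Lemma move2_swap l l' : move2 s l l' ->
  exists (p1 p2 : P) (k : passage) (b par : bool),
    [/\ if k is Under then False else True, uniq (disc [:: p1; p2]),
        forall p, p \in disc [:: p1; p2] -> l p = None,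
        crosses l' k b p1 (if par then p2 else s p2) /\
        crosses l' k (~~ b) (s p1) (if par then s p2 else p2)
      & eq_off (disc [:: p1; p2]) l l'].
Proof.
case=> p1 [p2 [k [b [par [uA lA x1 x2 ll']]]]].
have perm12 p q : perm_eq [:: p; s p; q; s q] (disc [:: p; q]).
  exact: perm_disc [:: p; q].
have perm21 : perm_eq [:: p1; s p1; p2; s p2] (disc [:: p2; p1]).
  by apply: perm_trans (perm12 p2 p1); rewrite (perm_catC [:: p1; s p1]).
have {perm12} := perm12 p1 p2 => perm12.
case: k x1 x2 => x1 x2.
- exists p1, p2, Over, b, par; split=> //; first by rewrite -(perm_uniq perm12).
    by move=> p; rewrite -(perm_mem perm12); exact: lA.
  by move=> p; rewrite -(perm_mem perm12); exact: ll'.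
(* Seen from the other strand a crossing has the opposite direction; for antiparallel strands the
   order of the crossings is also reversed, which restores [b]. *)
- exists p2, p1, Over, (if par then ~~ b else b), par; split=> //.
  + by rewrite -(perm_uniq perm21).
  + by move=> p; rewrite -(perm_mem perm21); exact: lA.
  + by rewrite /crosses in x1 x2 *; case: (par) (b) x1 x2 => [] [] [? ?] [? ?].
  by move=> p; rewrite -(perm_mem perm21); exact: ll'.
exists p1, p2, Virtual, b, par; split=> //; first by rewrite -(perm_uniq perm12).
  by move=> p; rewrite -(perm_mem perm12); exact: lA.
by move=> p; rewrite -(perm_mem perm12); exact: ll'.
Qed.

(** Each strand meets the other twice in opposite directions, so its colour is restored, and the
    weights cancel by [wtV]. *)
Lemma move2_replaceable phi l l' :
  cocycle2 op phi -> well_formed (Code s l) -> move2 s l l' ->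
  exists I, replaceable phi 1%g I l l'.
Proof.
move=> coc wf /move2_swap[p1 [p2 [k [b [par [kU uI lI x12 ll']]]]]].
exists [:: p1; p2]; set I := [:: p1; p2] in uI lI ll' *.
have [I1 I2] : p1 \in I /\ p2 \in I by rewrite !inE !eqxx orbT.
have [[n1 m1] [n2 m2]] := (uniq_disc_neighbours uI I1, uniq_disc_neighbours uI I2).
have [lp1 lsp1 lp2 lsp2] :
    [/\ l p1 = None, l (s p1) = None, l p2 = None & l (s p2) = None].
  by split; apply: lI; rewrite !inE !eqxx ?orbT.
apply: replaceable_of_layered => //.
- by move=> q k' b' p' /lI ->.
- by rewrite /= lp1 lp2.
- move: uI; rewrite /disc /= !inE !negb_or -!andbA; do ![case/andP=> ?] => _.
  case: k b par kU x12 => [] [] [] // _ [[L1 L2] [L3 L4]];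
    rewrite /= in L1 L2 L3 L4; rewrite L1 ?L2 ?L4 //= ?inE ?negb_or ?andbT //;
    by rewrite eq_sym.
- move=> c c' cc' /solvesP[ec lc] ec'.
  suff e : c' (s p1) = step l' c' (s p1) (c' p1) /\ c' (s p2) = step l' c' (s p2) (c' p2).
    by case: e => e1 e2 p; rewrite !inE => /orP[]/eqP->.
  move: (ec' p1 I1) (ec' p2 I2) (ec p1 I1) (lc p1 I1) (ec p2 I2) (lc p2 I2).
  rewrite /step lp1 lsp1 lp2 lsp2.
  case: k b par kU x12 => [] [] [] // _ [[L1 L2] [L3 L4]];
    rewrite /= in L1 L2 L3 L4; rewrite ?L1 ?L2 ?L3 ?L4;
    rewrite ?(cc' _ m1) ?(cc' _ m2) ?(cc' _ n1) ?(cc' _ n2) /= ?perm1;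
    move=> -> -> -> -> -> ->;
    by rewrite ?(crossK _ true) ?(crossK _ false) ?permK ?permKV.
- move=> c c' cc' /solvesP[ec lc] ec' p pI.
  have [n m] := uniq_disc_neighbours uI pI.
  rewrite /step !lI ?mem_cat ?map_f ?pI ?orbT // perm1 (ec' p pI) -!cc' //.
  rewrite /step !lI ?mem_cat ?map_f ?pI ?orbT // perm1.
  move: p pI {n m} => p; rewrite !inE.
  move: (ec p1 I1) (lc p1 I1) (ec p2 I2) (lc p2 I2).
  rewrite /step.
  case: k b par kU x12 => [] [] [] // _ [[L1 L2] [L3 L4]];
    rewrite /= in L1 L2 L3 L4; rewrite ?L1 ?L2 ?L3 ?L4 /= ?perm1;
    move=> e1 e2 e3 e4 /orP[]/eqP->; rewrite ?e4 ?e3 ?e2 ?e1;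
    by rewrite ?(crossK _ true) ?(crossK _ false) ?permK ?permKV.
move=> c c' cc' _ /solvesP[ec' lc'].
rewrite /disc_weight !big_cons !big_nil /point_weight lp1 lsp1 lp2 lsp2 !permK !umul1u.
move: (ec' p1 I1) (lc' p1 I1) (ec' p2 I2) (lc' p2 I2).
rewrite /step.
case: k b par kU x12 => [] [] [] // _ [[L1 L2] [L3 L4]];
  rewrite /= in L1 L2 L3 L4; rewrite ?L1 ?L2 ?L3 ?L4 /= ?perm1 ?umul1u //;
  move=> e1 e2 e3 e4; rewrite ?e3 ?e2 ?e1 ?Monoid.mulm1;
  by rewrite ?(wtV _ _ true) ?(wtV _ _ false) umuluV.
Qed.

Lemma move3_gen_replaceable phi k12 k23 k31 l l' :
  cocycle2 op phi -> well_formed (Code s l) ->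
  triangular k12 k23 k31 \/
    triangular (opposite k31) (opposite k23) (opposite k12) ->
  move3_gen s k12 k23 k31 l l' ->
  exists g I, g \in <[f]>%g /\ replaceable phi g I l l'.
Proof.
move=> coc wf kinds [p1 [p2 [p3 [b12 [b23 [b31 [d [uA tl tl' ll']]]]]]]].
have twist_f k b b' d' : triangle_twist k b b' d' \in <[f]>%g.
  by case: k; rewrite ?group1 // signed_cycle.
have perm123 : perm_eq [:: p1; s p1; p2; s p2; p3; s p3] (disc [:: p1; p2; p3]).
  exact: perm_disc [:: p1; p2; p3].
have perm132 : perm_eq [:: p1; s p1; p2; s p2; p3; s p3] (disc [:: p1; p3; p2]).
  apply: perm_trans (perm_disc [:: p1; p3; p2]).
  by rewrite !perm_cons (perm_catC [:: p2; s p2]).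
case: kinds => kinds.
  exists (triangle_twist k12 b12 b31 d), [:: p1; p2; p3]; split=> //.
  apply: (triangle_replaceable coc wf _ kinds tl tl').
    by rewrite -(perm_uniq perm123).
  by move=> p; rewrite -(perm_mem perm123); exact: ll'.
exists (triangle_twist (opposite k31) (~~ b31) (~~ b12) d), [:: p1; p3; p2]; split=> //.
apply: (triangle_replaceable coc wf _ kinds (triangle_swap tl) (triangle_swap tl')).
  by rewrite -(perm_uniq perm132).
by move=> p; rewrite -(perm_mem perm132); exact: ll'.
Qed.

Lemma reidemeister_replaceable phi l l' :
  cocycle2 op phi -> well_formed (Code s l) -> reidemeister s l l' ->
  exists g I, g \in <[f]>%g /\ replaceable phi g I l l'.
Proof.
move=> coc wf [m1|m2|m3|[m3|[m3|m3]]].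
- have [I r] := move1_replaceable coc wf m1.
  by exists 1%g, I; rewrite group1.
- have [I r] := move2_replaceable coc wf m2.
  by exists 1%g, I; rewrite group1.
- by apply: move3_gen_replaceable m3 => //; left.
- by apply: move3_gen_replaceable m3 => //; left.
- by apply: move3_gen_replaceable m3 => //; left.
by apply: move3_gen_replaceable m3 => //; right.
Qed.

End LocalMoves.

(** * Invariance *)

Section Invariance.
Variables (M : Type) (idx : M) (mul : Monoid.com_law idx) (F : units R -> M).
Variable phi : G -> G -> units R.

Definition segment_sum (D : code) : M :=
  \big[mul/idx]_(c in segment_colorings (succ D) (@lab D))
    F (total_weight (succ D) phi (@lab D) c).

Lemma segment_sum_isomorphic D D' : isomorphic D D' -> segment_sum D' = segment_sum D.
Proof.
case=> h [[g hK gK] hs hl].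
apply: (@big_refinement _ _ _ _ _ _ h g) => // [p|r]; last by rewrite gK eqxx.
by apply: (canLR hK); apply: (canLR (permK _)); rewrite -hs permKV.
Qed.

Lemma segment_sum_subdivides D D' : subdivides D' D -> segment_sum D' = segment_sum D.
Proof.
case=> h [p0 [q [h_inj himage hs qs [ql hl]]]].
(* The new point retracts to [p0], the start of the segment it divides; every other point is in the
   image of [h], so the default is never reached. *)
pose g r := if r == q then p0 else odflt p0 [pick p | h p == r].
have hq p : h p != q by apply/eqP; apply/himage; exists p.
have hK : cancel h g.
  move=> p; rewrite /g (negPf (hq p)).
  by case: pickP => [p' /eqP/h_inj //|/(_ p)]; rewrite eqxx.
have gq : g q = p0 by rewrite /g eqxx.
apply: (@big_refinement _ _ _ _ _ _ h g) => // [p|r hgr].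
  have := hs ((succ D)^-1%g p); rewrite permKV; case: eqP => [e _|_ <-].
    by rewrite e -gq; congr g; apply: (canLR (permK _)); rewrite qs -e permKV.
  by rewrite permK hK.
have [->|/eqP/himage[p rp]] := eqVneq r q; last by rewrite rp hK eqxx in hgr.
by rewrite ql gq; split=> //; apply: (canLR (permK _)); rewrite hs eqxx.
Qed.

Lemma segment_sum_same_virtual_link (D D' : diagram) :
  (forall (P : finType) (s : {perm P}) (l l' : P -> label P),
     well_formed (Code s l) -> reidemeister s l l' ->
     segment_sum (Code s l) = segment_sum (Code s l')) ->
  same_virtual_link D D' -> segment_sum D = segment_sum D'.
Proof.
move=> inv; elim=> {D D'} [D D' step||D D' _ ->|D D' D'' _ -> _ ->] //.
(* Well-formedness of the source is generalized with the step, so that it becomes available for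
   [Code s l]. *)
move: step (@diagram_wf D); case=> {D D'} [D D' iso|D D' sub|P s l l' r] wf.
- by rewrite (segment_sum_isomorphic iso).
- by rewrite (segment_sum_subdivides sub).
exact: inv.
Qed.

End Invariance.
End SegmentColorings.

Theorem theorem2p4 (G : finType) (op : G -> G -> G) (f : {perm G})
    (R : comPzRingType) :
  quandle op ->
  {morph f : a b / op a b} ->
  [/\ forall phi : G -> G -> units R, cocycle2 op phi ->
        forall D D' : diagram, same_virtual_link D D' ->
          Z1 op f phi D = Z1 op f phi D',
      forall phi : G -> G -> units R, cocycle2 op phi -> aligned f phi ->
        forall D D' : diagram, same_virtual_link D D' ->
          Z2 op f phi D = Z2 op f phi D'
    & forall phi phi' : G -> G -> units R,
        cocycle2 op phi -> cocycle2 op phi' -> cohomologous op phi phi' ->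
        forall D : diagram, Z1 op f phi D = Z1 op f phi' D].
Proof.
move=> Q f_morph.
have Z1E phi D : Z1 op f phi D = segment_sum f Q (@umul R) id phi D.
  exact: (big_colorings f Q (@umul R) id).
pose basis (u : units R) : {malg int[units R]} := << u >>%R.
have Z2E phi D : Z2 op f phi D = segment_sum f Q +%R%R basis phi D.
  exact: (big_colorings f Q +%R%R basis).
split=> [phi coc D D' DD'|phi coc phi_f D D' DD'|phi phi' _ _ h D].
- rewrite !Z1E; apply: segment_sum_same_virtual_link DD' => P s l l' wf r.
  have [g [I [g_f ll']]] := reidemeister_replaceable Q f_morph coc wf r.
  exact: (prod_replaceable f_morph ll' g_f).
- rewrite !Z2E.
  apply: segment_sum_same_virtual_link DD' => P s l l' wf r.
  have [g [I [g_f ll']]] := reidemeister_replaceable Q f_morph coc wf r.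
  exact: (big_replaceable_aligned f_morph ll' _ _ g_f (aligned_cycle phi_f g_f)).
by rewrite !Z1E; exact: (cohomologous_total_weight Q f_morph (succ D) (@lab D) h).
Qed.
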